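(* Let $\mathbf{V}_\star\in\mathbb{C}^n$ be a solution, with all entries nonzero, of $[\![\mathbf{V}_\star]\!]\,\overline{\mathbf{Y}(\mathbf{V}_\star-\mathbf{V}^0)}=\mathbf{S}_\star$, and let $\mathbf{Z}_\star,\mathbf{J}_\star,\mathbf{M}_\star,\mathbf{N}_\star$ be the associated matrices defined in the context, with $\mathbf{J}_\star$ nonsingular. Let $\lambda_M$ be the larger positive root $\lambda$ of the equation $$2\sqrt{\left(\|\mathbf{M}_\star\overline{\mathbf{Z}_\star}\|+\|\mathbf{N}_\star\mathbf{Z}_\star\|\right)\|\mathbf{J}_\star^{-1}\|\,\|\mathbf{Z}_\star\|\,\lambda\left(\|\mathbf{S}_\star\|+\lambda\right)}+2\left(\|\mathbf{M}_\star\overline{\mathbf{Z}_\star}\|+\|\mathbf{N}_\star\mathbf{Z}_\star\|\right)\lambda=1,$$ and set $$\lambda_{CAG}=\min\left\{\lambda_M,\ \frac{0.5}{\|\mathbf{M}_\star\overline{\mathbf{Z}_\star}\|+\|\mathbf{N}_\star\mathbf{Z}_\star\|}\right\}.$$ Then $\lambda_{CAG}$ is a certified admissible gain: for every $\Delta\mathbf{S}\in\mathbb{C}^n$ with $\|\Delta\mathbf{S}\|=1$, the injection $\mathbf{S}_\star+\lambda_{CAG}\,\Delta\mathbf{S}$ is solvable, so that $\lambda_{CAG}$ is a lower bound for $$\min_{\|\Delta\mathbf{S}\|=1}\ \max\{\lambda\ge 0:\ \mathbf{S}_\star+\lambda\,\Delta\mathbf{S}\ \text{is solvable}\}.$$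
   Context: Setting: a power network with one slack bus (index $0$, fixed voltage) and $n$ PQ buses, without shunt elements. $\mathbf{Y}\in\mathbb{C}^{n\times n}$ is the sub-matrix of the bus admittance matrix corresponding to the PQ buses; it is nonsingular. $\mathbf{V}^0=V^0\mathbf{1}\in\mathbb{C}^n$ is the constant vector all of whose entries equal the fixed complex number $V^0$ (the zero-injection voltage). An injection vector $\mathbf{S}\in\mathbb{C}^n$ is called solvable if the power flow equations $[\![\mathbf{V}]\!]\,\overline{\mathbf{Y}(\mathbf{V}-\mathbf{V}^0)}=\mathbf{S}$ have a solution $\mathbf{V}\in\mathbb{C}^n$. Given the base solution $\mathbf{V}_\star$ with injection $\mathbf{S}_\star$, define $$\mathbf{Z}_\star=[\![\overline{\mathbf{V}_\star}]\!]^{-1}\,\overline{\mathbf{Y}}^{-1}\,[\![\mathbf{V}_\star]\!]^{-1},\quad \mathbf{J}_\star=\begin{pmatrix}\mathbf{I} & \overline{\mathbf{Z}_\star}\,[\![\overline{\mathbf{S}_\star}]\!]\\ \mathbf{Z}_\star[\![\mathbf{S}_\star]\!] & \mathbf{I}\end{pmatrix},\quad \mathbf{J}_\star^{-1}=\begin{pmatrix}\mathbf{M}_\star & \mathbf{N}_\star\\ \overline{\mathbf{N}_\star} & \overline{\mathbf{M}_\star}\end{pmatrix}$$ (blocks are $n\times n$). Notation: $[\![\mathbf{x}]\!]$ is the diagonal matrix with diagonal $\mathbf{x}\in\mathbb{C}^n$; the overline denotes entrywise complex conjugation; $\mathbf{1}$ is the all-ones vector; $\mathbf{I}$ is the $n\times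 n$ identity matrix. For vectors, $\|\mathbf{x}\|=\max_i|x_i|$; for matrices, $\|\mathbf{A}\|=\max_i\sum_j|A_{ij}|$ (also for the $2n\times 2n$ matrix $\mathbf{J}_\star^{-1}$). The min and max in the displayed min-max problem are to be read as infimum and (possibly infinite) supremum if not attained. *)

(* Defs.v *)
From HB Require Import structures.
From mathcomp Require Import all_boot all_order all_algebra.
From mathcomp Require Import complex.
From mathcomp Require Import boolp classical_sets reals constructive_ereal ereal.

Set Implicit Arguments.
Unset Strict Implicit.
Unset Printing Implicit Defensive.

Import Order.TTheory GRing.Theory Num.Theory.

Local Open Scope ring_scope.

Section PowerFlow.
Context {R : realType}.
Local Notation C := R[i].

(* The library norm `|z| on R[i] is R[i]-valued; [Normc.normc] is the real
   modulus. Moduli and row sums are nonnegative, so 0 is a neutral default for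
   the maxima. *)
Definition vnorm (n : nat) (x : 'cV[C]_n) : R :=
  \big[Num.max/0]_(i < n) Normc.normc (x i 0).

Definition mnorm (m n : nat) (A : 'M[C]_(m, n)) : R :=
  \big[Num.max/0]_(i < m) \sum_(j < n) Normc.normc (A i j).

Definition conjmx (m n : nat) (A : 'M[C]_(m, n)) : 'M[C]_(m, n) :=
  map_mx conjc A.

Definition diagv (n : nat) (x : 'cV[C]_n) : 'M[C]_n := diag_mx x^T.

(* For i != j, [y i j] is the admittance of the branch between buses i and j
   (0 if there is none); diagonal entries of [y] are ignored. Without shunt
   elements the diagonal of the bus admittance matrix is the sum of the incident
   branch admittances, i.e. all row sums vanish. Symmetry of [y] is not
   required, so nonreciprocal branches are allowed. *)
Definition bus_admittance (N : nat) (y : 'M[C]_N) : 'M[C]_N :=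
  \matrix_(i, j) if i == j then \sum_(k | k != i) y i k else - y i j.

(* Bus 0 is the slack bus, buses 1..n are the PQ buses. *)
Definition pq_admittance (n : nat) (y : 'M[C]_(1 + n)) : 'M[C]_n :=
  drsubmx (bus_admittance y).

Definition power_flow (n : nat) (Y : 'M[C]_n) (V0 : C) (V S : 'cV[C]_n) : Prop :=
  diagv V *m conjmx (Y *m (V - const_mx V0)) = S.

Definition solvable (n : nat) (Y : 'M[C]_n) (V0 : C) (S : 'cV[C]_n) : Prop :=
  exists V : 'cV[C]_n, power_flow Y V0 V S.

Definition Zmat (n : nat) (Y : 'M[C]_n) (V : 'cV[C]_n) : 'M[C]_n :=
  invmx (diagv (conjmx V)) *m invmx (conjmx Y) *m invmx (diagv V).

Definition Jmat (n : nat) (Y : 'M[C]_n) (V S : 'cV[C]_n) : 'M[C]_(n + n) :=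
  let Z := Zmat Y V in
  block_mx 1%:M (conjmx Z *m diagv (conjmx S))
           (Z *m diagv S) 1%:M.

(* Exchanging the two block rows and the two block columns of J conjugates it,
   so the lower blocks of J^-1 are the conjugates of N and M. *)
Definition Mmat (n : nat) (Y : 'M[C]_n) (V S : 'cV[C]_n) : 'M[C]_n :=
  ulsubmx (invmx (Jmat Y V S)).

Definition Nmat (n : nat) (Y : 'M[C]_n) (V S : 'cV[C]_n) : 'M[C]_n :=
  ursubmx (invmx (Jmat Y V S)).

(* ||M conj(Z)|| + ||N Z|| *)
Definition MNZ_norm (n : nat) (Y : 'M[C]_n) (V S : 'cV[C]_n) : R :=
  mnorm (Mmat Y V S *m conjmx (Zmat Y V)) + mnorm (Nmat Y V S *m Zmat Y V).

Definition gain_root (n : nat) (Y : 'M[C]_n) (V S : 'cV[C]_n) (lam : R) : Prop :=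
  let c := MNZ_norm Y V S in
  2 * Num.sqrt (c * mnorm (invmx (Jmat Y V S)) * mnorm (Zmat Y V)
                * (lam * (vnorm S + lam)))
  + 2 * c * lam = 1.

Definition is_lambda_M (n : nat) (Y : 'M[C]_n) (V S : 'cV[C]_n) (lam : R) : Prop :=
  [/\ 0 < lam, gain_root Y V S lam &
      forall mu : R, 0 < mu -> gain_root Y V S mu -> mu <= lam].

Definition lambda_CAG (n : nat) (Y : 'M[C]_n) (V S : 'cV[C]_n) (lamM : R) : R :=
  Num.min lamM (2^-1 / MNZ_norm Y V S).

Local Open Scope classical_set_scope.

Definition max_gain (n : nat) (Y : 'M[C]_n) (V0 : C) (S dS : 'cV[C]_n) : \bar R :=
  ereal_sup [set lam%:E | lam in
    [set lam : R | 0 <= lam /\ solvable Y V0 (S + lam%:C%C *: dS)]].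

Definition worst_case_gain (n : nat) (Y : 'M[C]_n) (V0 : C) (S : 'cV[C]_n) : \bar R :=
  ereal_inf [set max_gain Y V0 S dS | dS in [set dS : 'cV[C]_n | vnorm dS = 1]].

End PowerFlow.

(* Main.v *)
Require Import Defs.
From HB Require Import structures.
From mathcomp Require Import all_boot all_order all_algebra.
From mathcomp Require Import complex.
From mathcomp Require Import boolp classical_sets reals constructive_ereal ereal.
From mathcomp Require Import ring lra.

(** Relative to the base solution write V = V_* (1 + u), entrywise.  Conjugating
    and dividing the power flow equation for S_* + lam d by V_* turns it into
      conj u = Z ((S_* + lam d) / (1 + u) - S_* ),
    and since 1 / (1 + u) = 1 - u + g(u) with g(u) = u^2 / (1 + u), the part
    linear in (u, conj u) can be moved to the left:
      conj u + Z [[S_*]] u = Z r(u),   r(u) = S_* g(u) + lam d / (1 + u).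
    Together with its conjugate this is a linear system with matrix J, so it is
    the fixed-point equation u = M conj Z conj r(u) + N Z r(u).

    Put k = ||(M conj Z | N Z)|| and s = ||S_*||.  On ||u|| <= t < 1 the
    right-hand side is controlled, both in size and in its increments, by the
    scalar function
      h(t) = k (s t^2 + lam) / (1 - t),
    and h(rho) <= rho for rho = 1 / (2 (k s + 1)) as soon as
    4 k lam (k s + 1) <= 1.  At equality h has slope 1 at its fixed point, so
    the map need not be a contraction; this case does occur at the certified
    gain.  Kantorovich's majorant principle ([majorant_fixed_point]) still
    applies: the Picard iterates move by at most the increments of the bounded
    monotone sequence of iterates of h, hence converge.

    The condition follows from the equation defining lambda_M
    ([gain_root_condition]).  With c = ||M conj Z|| + ||N Z|| and
    a = ||J^-1|| ||Z||, one has k <= c by the triangle inequality and k <= a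
    because (M conj Z | N Z) is the product of the upper half of J^-1 with
    diag (conj Z, Z).  Both bounds matter: c may exceed a, as the maximal row
    sums of M and N may be attained in different rows.  Since c > 0, the
    left-hand side of the gain equation increases strictly from 0 to infinity,
    so lambda_M exists, is the only positive root, and is at most
    1 / (2 c); the minimum defining lambda_CAG is therefore lambda_M. *)

Import Order.TTheory GRing.Theory Num.Theory.

Local Open Scope ring_scope.

(* The matrix library has another [conjmx]; this import makes the name denote
   entrywise conjugation again. *)
Import Normc Defs.

Set Implicit Arguments.
Unset Strict Implicit.
Unset Printing Implicit Defensive.

(** * The real modulus of a complex number *)

Section Modulus.
Context {R : realType}.
Implicit Types z w : R[i].

Lemma normcC z : (normc z)%:C%C = `|z|.
Proof. by rewrite normc_def; case: z => a b; rewrite /normc /=. Qed.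

Lemma normc_ge0 z : 0 <= normc z.
Proof. by rewrite -lecR normcC normr_ge0. Qed.

Lemma normcD_le z w : normc (z + w) <= normc z + normc w.
Proof. by rewrite -lecR rmorphD /= !normcC ler_normD. Qed.

Lemma normc_opp z : normc (- z) = normc z.
Proof. by apply: (@complexI R); rewrite !normcC normrN. Qed.

Lemma normcB_le z w : normc (z - w) <= normc z + normc w.
Proof. by rewrite -[normc w]normc_opp normcD_le. Qed.

Lemma normc_distC z w : normc (z - w) = normc (w - z).
Proof. by rewrite -normc_opp opprB. Qed.

Lemma normc_conj z : normc (conjc z) = normc z.
Proof. by apply: (@complexI R); rewrite !normcC normcJ. Qed.

Lemma normc_real (x : R) : 0 <= x -> normc x%:C%C = x.
Proof. by move=> x0; rewrite /normc /= expr0n addr0 sqrtr_sqr ger0_norm. Qed.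

Lemma normc_sum (I : finType) (F : I -> R[i]) :
  normc (\sum_i F i) <= \sum_i normc (F i).
Proof.
apply: (big_ind2 (fun z x => normc z <= x)) => // [|z a w b za wb].
  by rewrite normc0.
exact: le_trans (normcD_le _ _) (lerD za wb).
Qed.

Lemma normc_Re z : `|complex.Re z| <= normc z.
Proof. by rewrite -lecR normcC normc_ge_Re. Qed.

Lemma normc_Im z : `|complex.Im z| <= normc z.
Proof.
have -> : complex.Im z = - complex.Re (z * 'i%C) by rewrite ReiNIm opprK.
rewrite normrN (le_trans (normc_Re _)) // normcM.
by rewrite [normc 'i%C]/normc /= expr0n expr1n add0r sqrtr1 mulr1.
Qed.

Lemma normc_le_ReIm z : normc z <= `|complex.Re z| + `|complex.Im z|.
Proof.
case: z => a b /=; apply: le_trans (_ : Num.sqrt ((`|a| + `|b|) ^+ 2) <= _).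
  apply: ler_wsqrtr; rewrite sqrrD !real_normK ?num_real //.
  have : 0 <= `|a| * `|b| by rewrite mulr_ge0.
  lra.
by rewrite sqrtr_sqr ger0_norm ?addr_ge0.
Qed.

End Modulus.

(** * Maximum norm and maximal row sum norm *)

Section Norms.
Context {R : realType}.
Local Notation C := R[i].

Lemma vnorm_ge0 n (x : 'cV[C]_n) : 0 <= vnorm x.
Proof.
rewrite /vnorm; elim/big_rec: _ => // i a _ a0.
by rewrite le_max a0 orbT.
Qed.

Lemma le_vnorm n (x : 'cV[C]_n) i : normc (x i 0) <= vnorm x.
Proof. exact: (le_bigmax _ (fun i => normc (x i 0))). Qed.

Lemma vnorm_leP n (x : 'cV[C]_n) b : 0 <= b ->
  reflect (forall i, normc (x i 0) <= b) (vnorm x <= b).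
Proof.
move=> b0; apply: (iffP idP) => [xb i|xb].
  exact: le_trans (le_vnorm _ _) xb.
by apply: bigmax_le.
Qed.

Lemma vnormD_le n (x z : 'cV[C]_n) : vnorm (x + z) <= vnorm x + vnorm z.
Proof.
apply/vnorm_leP => [|i]; first by rewrite addr_ge0 ?vnorm_ge0.
by rewrite mxE (le_trans (normcD_le _ _)) ?lerD ?le_vnorm.
Qed.

Lemma vnorm0 n : vnorm (0 : 'cV[C]_n) = 0.
Proof.
apply/eqP; rewrite eq_le vnorm_ge0 andbT; apply/vnorm_leP => // i.
by rewrite mxE normc0.
Qed.

Lemma vnorm_le0 n (x : 'cV[C]_n) : vnorm x <= 0 -> x = 0.
Proof.
move/vnorm_leP => /(_ (lexx _)) x0; apply/matrixP => i j.
rewrite ord1 mxE; apply: eq0_normc; apply/eqP.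
by rewrite eq_le x0 normc_ge0.
Qed.

Lemma vnorm_distC n (x z : 'cV[C]_n) : vnorm (x - z) = vnorm (z - x).
Proof.
by rewrite /vnorm; apply: eq_bigr => i _; rewrite !mxE normc_distC.
Qed.

Lemma mnorm_ge0 m n (A : 'M[C]_(m, n)) : 0 <= mnorm A.
Proof.
rewrite /mnorm; elim/big_rec: _ => // i a _ a0.
by rewrite le_max a0 orbT.
Qed.

Lemma le_mnorm m n (A : 'M[C]_(m, n)) i : \sum_j normc (A i j) <= mnorm A.
Proof. exact: (le_bigmax _ (fun i => \sum_j normc (A i j))). Qed.

Lemma mnorm_leP m n (A : 'M[C]_(m, n)) b : 0 <= b ->
  reflect (forall i, \sum_j normc (A i j) <= b) (mnorm A <= b).
Proof.
move=> b0; apply: (iffP idP) => [xb i|xb].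
  exact: le_trans (le_mnorm _ _) xb.
by apply: bigmax_le.
Qed.

Lemma mnorm_eq0 m n (A : 'M[C]_(m, n)) : mnorm A = 0 -> A = 0.
Proof.
move=> A0; apply/matrixP => i j; rewrite mxE; apply: eq0_normc.
have := le_mnorm A i; rewrite A0 => A_le0.
have /eqP : \sum_j normc (A i j) = 0.
  by apply/eqP; rewrite eq_le A_le0 sumr_ge0 // => k _; exact: normc_ge0.
rewrite psumr_eq0 => [/allP/(_ j)/(_ (mem_index_enum _))/eqP //|k _].
exact: normc_ge0.
Qed.

Lemma mnorm_mulmx m n p (A : 'M[C]_(m, n)) (B : 'M[C]_(n, p)) :
  mnorm (A *m B) <= mnorm A * mnorm B.
Proof.
apply/mnorm_leP => [|i]; first by rewrite mulr_ge0 ?mnorm_ge0.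
apply: le_trans (_ : \sum_k normc (A i k) * mnorm B <= _); last first.
  by rewrite -mulr_suml ler_wpM2r ?mnorm_ge0 ?le_mnorm.
apply: le_trans (_ : \sum_j \sum_k normc (A i k) * normc (B k j) <= _).
  apply: ler_sum => j _; rewrite mxE (le_trans (normc_sum _)) //.
  by apply: ler_sum => k _; rewrite normcM.
rewrite exchange_big /=; apply: ler_sum => k _.
by rewrite -mulr_sumr ler_wpM2l ?normc_ge0 ?le_mnorm.
Qed.

Lemma mnorm_cV n (x : 'cV[C]_n) : mnorm x = vnorm x.
Proof. by apply: eq_bigr => i _; rewrite big_ord1. Qed.

Lemma mnorm_conj m n (A : 'M[C]_(m, n)) : mnorm (conjmx A) = mnorm A.
Proof.
apply: eq_bigr => i _; apply: eq_bigr => j _.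
by rewrite mxE normc_conj.
Qed.

Lemma mnorm_row_mx m n1 n2 (A : 'M[C]_(m, n1)) (B : 'M[C]_(m, n2)) :
  mnorm (row_mx A B) <= mnorm A + mnorm B.
Proof.
apply/mnorm_leP => [|i]; first by rewrite addr_ge0 ?mnorm_ge0.
rewrite big_split_ord /= lerD // -?(le_mnorm _ i) //.
  by under eq_bigr do rewrite row_mxEl; exact: le_mnorm.
by under eq_bigr do rewrite row_mxEr; exact: le_mnorm.
Qed.

Lemma mnorm_col_mx m1 m2 n (A : 'M[C]_(m1, n)) (B : 'M[C]_(m2, n)) :
  mnorm (col_mx A B) = Num.max (mnorm A) (mnorm B).
Proof.
apply/eqP; rewrite eq_le; apply/andP; split.
  apply/mnorm_leP => [|i]; first by rewrite le_max mnorm_ge0.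
  rewrite le_max; case: (split_ordP i) => k ->.
    under eq_bigr do rewrite col_mxEu; by rewrite le_mnorm.
  under eq_bigr do rewrite col_mxEd; by rewrite le_mnorm orbT.
rewrite ge_max; apply/andP; split; apply/mnorm_leP; rewrite ?mnorm_ge0 // => i.
  by have := le_mnorm (col_mx A B) (lshift m2 i);
    under eq_bigr do rewrite col_mxEu.
by have := le_mnorm (col_mx A B) (rshift m1 i);
    under eq_bigr do rewrite col_mxEd.
Qed.

Lemma mnorm_row_mx0 m n1 n2 (A : 'M[C]_(m, n1)) :
  mnorm (row_mx A (0 : 'M_(m, n2))) = mnorm A.
Proof.
apply: eq_bigr => i _; rewrite big_split_ord /=.
under eq_bigr do rewrite row_mxEl.
by rewrite [X in _ + X]big1 ?addr0 // => j _; rewrite row_mxEr mxE normc0.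
Qed.

Lemma mnorm_row_0mx m n1 n2 (A : 'M[C]_(m, n2)) :
  mnorm (row_mx (0 : 'M_(m, n1)) A) = mnorm A.
Proof.
apply: eq_bigr => i _; rewrite big_split_ord /=.
under [X in _ + X]eq_bigr do rewrite row_mxEr.
by rewrite [X in X + _]big1 ?add0r // => j _; rewrite row_mxEl mxE normc0.
Qed.

End Norms.

(** * Kantorovich's majorant principle *)

Section Limit.
Context {R : realType}.

(** Passage to the limit along a bounded sequence t: the gap to its supremum can
    be made arbitrarily small. *)
Lemma sup_gap_le (t : nat -> R) b : (forall k, t k <= b) ->
  forall (a c K : R), 0 <= K ->
  (forall k, a <= c + K * (sup (range t) - t k)) -> a <= c.
Proof.
move=> tb a c K K0 H.
have ht : has_sup (range t).
  by split; [exists (t 0%N), 0%N|exists b => _ [k _ <-]].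
apply/ler_addgt0Pr => e e0.
have K1 : 0 < K + 1 by lra.
have [_ [k _ <-] tk] := sup_adherent (divr_gt0 e0 K1) ht.
apply: le_trans (H k) _; rewrite lerD2l.
have tk0 : 0 <= sup (range t) - t k.
  by rewrite subr_ge0; apply: sup_upper_bound => //; exists k.
have : sup (range t) - t k <= e / (K + 1) by lra.
rewrite ler_pdivlMr //; nra.
Qed.

(** Both x + t and t - x are nondecreasing, and x + t is bounded, so the limit
    of x is the difference of the suprema of x + t and t. *)
Lemma dominated_seq_limit (x t : nat -> R) b :
  (forall k, t k <= b) ->
  (forall k, `|x k.+1 - x k| <= t k.+1 - t k) ->
  exists l, forall k, `|l - x k| <= sup (range t) - t k.
Proof.
move=> tb xt.
have tS k : t k <= t k.+1.
  by rewrite -subr_ge0 (le_trans _ (xt k)).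
have ht : has_sup (range t).
  by split; [exists (t 0%N), 0%N|exists b => _ [k _ <-]].
have tle k : t k <= sup (range t) by apply: sup_upper_bound => //; exists k.
have y_mono : {homo (fun k => x k + t k) : k m / (k <= m)%N >-> k <= m}.
  apply: (homo_leq (@lexx _ _) (@le_trans _ _)) => k.
  by move: (xt k); rewrite ler_norml => /andP[]; lra.
have z_mono : {homo (fun k => t k - x k) : k m / (k <= m)%N >-> k <= m}.
  apply: (homo_leq (@lexx _ _) (@le_trans _ _)) => k.
  by move: (xt k); rewrite ler_norml => /andP[]; lra.
have y_le k m : x m + t m <= x k + t k + 2 * (sup (range t) - t k).
  have := tle k; have := tle m.
  case: (leqP m k) => [mk|/ltnW km]; first by have := y_mono _ _ mk; lra.
  by have := z_mono _ _ km; lra.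
set Y := range (fun k => x k + t k).
have hY : has_sup Y.
  split; first by exists (x 0%N + t 0%N), 0%N.
  by exists (x 0%N + t 0%N + 2 * (sup (range t) - t 0%N)) => _ [m _ <-].
exists (sup Y - sup (range t)) => k.
have Yk : x k + t k <= sup Y by apply: sup_upper_bound => //; exists k.
have kY : sup Y <= x k + t k + 2 * (sup (range t) - t k).
  by apply: ge_sup => [|_ [m _ <-]//]; case: hY.
by rewrite ler_norml; apply/andP; split; lra.
Qed.

(** The factor 2 comes from treating real and imaginary parts separately; it is
    harmless, as the bound only serves to pass to the limit. *)
Lemma dominated_seq_limitC (z : nat -> R[i]) (t : nat -> R) b :
  (forall k, t k <= b) ->
  (forall k, normc (z k.+1 - z k) <= t k.+1 - t k) ->
  exists l, forall k, normc (l - z k) <= 2 * (sup (range t) - t k).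
Proof.
move=> tb zt.
have [k|lr Hr] := @dominated_seq_limit (fun k => complex.Re (z k)) t b tb.
  by apply: le_trans (zt k); rewrite -raddfB; exact: normc_Re.
have [k|li Hi] := @dominated_seq_limit (fun k => complex.Im (z k)) t b tb.
  by apply: le_trans (zt k); rewrite -raddfB; exact: normc_Im.
exists (Complex lr li) => k; apply: le_trans (normc_le_ReIm _) _.
rewrite !raddfB /=; have := Hr k; have := Hi k; lra.
Qed.

(** The iterates of T from 0 advance by at most the increments of the iterates
    of h from 0, which increase and stay below rho; so they converge even if h
    has slope 1 at its fixed point.  The Lipschitz constant L may be large: it only
    makes T continuous on the ball, so that the limit is a fixed point. *)
Theorem majorant_fixed_point n (T : 'cV[R[i]]_n -> 'cV[R[i]]_n) (h : R -> R)
    (rho L : R) :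
  0 <= rho -> h rho <= rho -> 0 <= L ->
  vnorm (T 0) <= h 0 ->
  (forall t s u w, 0 <= s -> s <= t -> t <= rho ->
     vnorm w <= s -> vnorm (u - w) <= t - s ->
     vnorm (T u - T w) <= h t - h s) ->
  (forall u w, vnorm u <= rho -> vnorm w <= rho ->
     vnorm (T u - T w) <= L * vnorm (u - w)) ->
  exists2 u, vnorm u <= rho & T u = u.
Proof.
move=> rho0 h_rho L0 T0 maj lip.
have h_mono s t : 0 <= s -> s <= t -> t <= rho -> h s <= h t.
  (* monotonicity of h is the majorization of T at u = w = 0 *)
  move=> s0 st tr; rewrite -subr_ge0.
  by apply: le_trans (vnorm_ge0 (T 0 - T 0)) _; apply: maj => //;
    rewrite ?subrr vnorm0 // subr_ge0.
pose t k := iter k h 0; pose u k := iter k T 0.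
have t_step k : [/\ 0 <= t k, t k <= t k.+1 & t k.+1 <= rho].
  elim: k => [|k [tk0 tkS tkr]]; rewrite /t /=.
    rewrite lexx; split=> //; first exact: le_trans (vnorm_ge0 _) T0.
    by apply: le_trans h_rho; apply: h_mono.
  rewrite -/(t k) -/(t k.+1); split; first exact: le_trans tkS.
    exact: h_mono.
  apply: le_trans h_rho; apply: h_mono => //; exact: le_trans tkS.
have tb k : t k <= rho by case: (t_step k) => _; exact: le_trans.
have u_step k : vnorm (u k) <= t k /\ vnorm (u k.+1 - u k) <= t k.+1 - t k.
  elim: k => [|k [uk ukS]]; first by rewrite /= subr0 subr0 vnorm0.
  have [tk0 tkS tkr] := t_step k.
  split; last by apply: maj.
  by rewrite -(subrK (u k) (u k.+1)) (le_trans (vnormD_le _ _)) //; lra.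
have /choice [l Hl] : forall i, exists l, forall k,
    normc (l - u k i 0) <= 2 * (sup (range t) - t k).
  move=> i; apply: (dominated_seq_limitC tb) => k.
  have [_ /(le_trans (le_vnorm _ i))] := u_step k.
  by rewrite !mxE.
pose v : 'cV[R[i]]_n := \col_i l i.
have vu k : vnorm (v - u k) <= 2 * (sup (range t) - t k).
  apply/vnorm_leP => [|i]; last by rewrite !mxE.
  rewrite mulr_ge0 // subr_ge0; apply: sup_upper_bound; last by exists k.
  by split; [exists (t 0%N), 0%N|exists rho => _ [m _ <-]].
have v_rho : vnorm v <= rho.
  apply: (sup_gap_le (t := t) (K := 2) tb) => // k.
  rewrite -(subrK (u k) v) (le_trans (vnormD_le _ _)) //.
  by have := vu k; have [? _] := u_step k; have := tb k; lra.
exists v => //; apply/eqP; rewrite -subr_eq0; apply/eqP/vnorm_le0.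
apply: (sup_gap_le (t := t) (K := 2 * L + 2) tb) => [|k]; first by lra.
have -> : T v - v = (T v - T (u k)) + (u k.+1 - v).
  by rewrite addrA subrK.
have [uk _] := u_step k; have [tk0 tkS _] := t_step k.
apply: le_trans (vnormD_le _ _) _; rewrite (vnorm_distC _ v).
have := lip v (u k) v_rho (le_trans uk (tb k)).
have := ler_wpM2l L0 (vu k); have := vu k.+1; lra.
Qed.

End Limit.

(** * The nonlinear part of the power flow equation *)

Section Remainder.
Context {R : realType}.
Local Notation C := R[i].

Lemma inv1D_bound (z : C) t : normc z <= t -> t < 1 ->
  1 + z != 0 /\ normc (1 + z)^-1 <= (1 - t)^-1.
Proof.
move=> zt t1; have z1 : 1 - t <= normc (1 + z).
  have := normcB_le (1 + z) z; rewrite addrK normc1; lra.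
have z0 : 0 < normc (1 + z) by lra.
split; last by rewrite normcV lef_pV2 // posrE; lra.
by apply: contraTneq z0 => ->; rewrite normc0 ltxx.
Qed.

(** Coefficientwise domination: the left-hand side is a power series in (z, w)
    whose coefficients are bounded in modulus by those of the series of the
    right-hand side in (t, s). *)
Lemma inv1D_prod_bound (z w : C) t s :
  normc z <= t -> t < 1 -> normc w <= s -> s < 1 ->
  normc (1 - (1 + z)^-1 * (1 + w)^-1) <= (1 - t)^-1 * (1 - s)^-1 - 1.
Proof.
move=> zt t1 ws s1.
have [z0 zb] := inv1D_bound zt t1; have [w0 wb] := inv1D_bound ws s1.
have -> : 1 - (1 + z)^-1 * (1 + w)^-1
    = z * (1 + z)^-1 + (1 + z)^-1 * (w * (1 + w)^-1).
  by field; rewrite z0 w0.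
have -> : (1 - t)^-1 * (1 - s)^-1 - 1
    = t * (1 - t)^-1 + (1 - t)^-1 * (s * (1 - s)^-1).
  by field; rewrite !subr_eq0 !gt_eqF.
apply: le_trans (normcD_le _ _) _; rewrite !normcM.
have t0 : 0 <= t := le_trans (normc_ge0 _) zt.
by rewrite lerD ?ler_pM ?mulr_ge0 ?normc_ge0 ?invr_ge0 //; lra.
Qed.

(** The right-hand side r(u) of the equation for the relative voltage change u:
    u + 1 / (1 + u) - 1 equals u^2 / (1 + u), the part of 1 / (1 + u) beyond
    first order.  The form below shows that increments of r factor through
    u - w. *)
Definition remainder n (S d : 'cV[C]_n) (lam : R) (u : 'cV[C]_n) : 'cV[C]_n :=
  \col_i (S i 0 * (u i 0 + (1 + u i 0)^-1 - 1)
          + lam%:C%C * d i 0 * (1 + u i 0)^-1).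

(** Both terms of r have increments with a factor 1 / ((1 + u) (1 + w)), because
    1 / (1 + u) - 1 / (1 + w) = (w - u) / ((1 + u) (1 + w)).  Two independent
    radii are kept: taking them different gives the exact increments of the
    majorant, and taking them equal a Lipschitz bound. *)
Lemma remainder_diff n (S d : 'cV[C]_n) (lam t s : R) (u w : 'cV[C]_n) :
  0 <= lam -> vnorm d <= 1 ->
  vnorm u <= t -> t < 1 -> vnorm w <= s -> s < 1 ->
  vnorm (remainder S d lam u - remainder S d lam w)
  <= vnorm (u - w) * (vnorm S * ((1 - t)^-1 * (1 - s)^-1 - 1)
                      + lam * ((1 - t)^-1 * (1 - s)^-1)).
Proof.
move=> lam0 d1 ut t1 ws s1.
have t0 := le_trans (vnorm_ge0 u) ut; have s0 := le_trans (vnorm_ge0 w) ws.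
have P1 : 1 <= (1 - t)^-1 by rewrite invf_ge1 ?subr_gt0 ?gerBl.
have Q1 : 1 <= (1 - s)^-1 by rewrite invf_ge1 ?subr_gt0 ?gerBl.
have PQ1 : 0 <= (1 - t)^-1 * (1 - s)^-1 - 1 by rewrite subr_ge0 mulr_ege1.
have PQ0 : 0 <= (1 - t)^-1 * (1 - s)^-1 by lra.
apply/vnorm_leP => [|i].
  by rewrite mulr_ge0 ?vnorm_ge0 // addr_ge0 // mulr_ge0 // vnorm_ge0.
have uti := le_trans (le_vnorm u i) ut; have wsi := le_trans (le_vnorm w i) ws.
have [u0 ub] := inv1D_bound uti t1; have [w0 wb] := inv1D_bound wsi s1.
have := le_vnorm (u - w) i; rewrite !mxE => uwi.
set p := u i 0 in u0 ub uti uwi *; set q := w i 0 in w0 wb wsi uwi *.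
have -> : S i 0 * (p + (1 + p)^-1 - 1) + lam%:C%C * d i 0 * (1 + p)^-1
    - (S i 0 * (q + (1 + q)^-1 - 1) + lam%:C%C * d i 0 * (1 + q)^-1)
  = (p - q) * (S i 0 * (1 - (1 + p)^-1 * (1 + q)^-1)
               - lam%:C%C * d i 0 * ((1 + p)^-1 * (1 + q)^-1)).
  by field; rewrite u0 w0.
rewrite normcM ler_pM ?normc_ge0 //; apply: le_trans (normcB_le _ _) _.
rewrite !normcM (normc_real lam0) lerD ?ler_pM ?mulr_ge0 ?normc_ge0 //.
- exact: le_vnorm.
- exact: inv1D_prod_bound.
- by rewrite -[leRHS]mulr1 ler_pM ?normc_ge0 ?(le_trans (le_vnorm _ _)).
Qed.


(** The function h(t) = k (s t^2 + lam) / (1 - t), in the form whose increments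
    match [remainder_diff]. *)
Definition majorant (k s lam t : R) : R :=
  k * (s * ((1 - t)^-1 - 1 - t) + lam * (1 - t)^-1).

(** Treating the two products as one product with a block row keeps the norm of
    the row, which can be smaller than the sum of the two norms. *)
Lemma vnorm_row_mul n (A B : 'M[C]_n) (r r' : 'cV[C]_n) :
  vnorm r' = vnorm r ->
  vnorm (A *m r' + B *m r) <= mnorm (row_mx A B) * vnorm r.
Proof.
move=> rr'; rewrite -mul_row_col -!mnorm_cV (le_trans (mnorm_mulmx _ _)) //.
by rewrite mnorm_col_mx !mnorm_cV rr' maxxx.
Qed.

Lemma vnorm_conj n (x : 'cV[C]_n) : vnorm (conjmx x) = vnorm x.
Proof. by rewrite -!mnorm_cV mnorm_conj. Qed.

Lemma remainder0 n (S d : 'cV[C]_n) lam : remainder S d lam 0 = lam%:C%C *: d.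
Proof.
apply/matrixP => i j.
by rewrite ord1 !mxE addr0 invr1 add0r subrr mulr0 add0r mulr1.
Qed.

Lemma conjmxB m n (A B : 'M[C]_(m, n)) : conjmx (A - B) = conjmx A - conjmx B.
Proof. exact: map_mxB. Qed.

Lemma conjmxD m n (A B : 'M[C]_(m, n)) : conjmx (A + B) = conjmx A + conjmx B.
Proof. exact: map_mxD. Qed.

Lemma conjmxM m n p (A : 'M[C]_(m, n)) (B : 'M[C]_(n, p)) :
  conjmx (A *m B) = conjmx A *m conjmx B.
Proof. exact: map_mxM. Qed.

Lemma conjmxK m n (A : 'M[C]_(m, n)) : conjmx (conjmx A) = A.
Proof. by apply/matrixP => i j; rewrite !mxE conjcK. Qed.

Lemma conjmx_diagv n (x : 'cV[C]_n) : conjmx (diagv x) = diagv (conjmx x).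
Proof. by rewrite /diagv /conjmx map_diag_mx map_trmx. Qed.

Lemma conjmx_unit n (A : 'M[C]_n) : (conjmx A \in unitmx) = (A \in unitmx).
Proof. exact: map_unitmx. Qed.

Lemma diagv_unit n (x : 'cV[C]_n) :
  (forall i, x i 0 != 0) -> diagv x \in unitmx.
Proof.
move=> x0; rewrite unitmxE unitfE det_diag; apply/prodf_neq0 => i _.
by rewrite mxE.
Qed.

Lemma mul_diagv n (x z : 'cV[C]_n) i : (diagv x *m z) i 0 = x i 0 * z i 0.
Proof. by rewrite /diagv mul_diag_mx !mxE. Qed.

(** The condition on lam says that the quadratic
    (k s + 1) t^2 - t + k lam, whose sign is that of h(t) - t on [0, 1), is
    nonpositive at its vertex. *)
Lemma reduced_fixed_point n (A B : 'M[C]_n) (S d : 'cV[C]_n) (lam : R) :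
  let k := mnorm (row_mx A B) in
  0 <= lam -> vnorm d <= 1 ->
  4 * k * lam * (k * vnorm S + 1) <= 1 ->
  exists2 u, vnorm u < 1 &
    A *m conjmx (remainder S d lam u) + B *m remainder S d lam u = u.
Proof.
move=> k lam0 d1 hk; set s := vnorm S in hk.
have k0 : 0 <= k by exact: mnorm_ge0.
have s0 : 0 <= s by exact: vnorm_ge0.
have ks0 : 0 <= k * s by rewrite mulr_ge0.
(* the vertex of the quadratic; it is at most 1/2 *)
pose rho := (2 * (k * s + 1))^-1.
have rhoE : rho * (2 * (k * s + 1)) = 1 by rewrite mulVf //; lra.
have rho0 : 0 < rho by rewrite invr_gt0; lra.
have rho2 : rho <= 2^-1 by rewrite lef_pV2 ?posrE; lra.
pose T u := A *m conjmx (remainder S d lam u) + B *m remainder S d lam u.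
have T_diff u w t r : vnorm u <= t -> t < 1 -> vnorm w <= r -> r < 1 ->
    vnorm (T u - T w) <= k * (vnorm (u - w) *
      (s * ((1 - t)^-1 * (1 - r)^-1 - 1) + lam * ((1 - t)^-1 * (1 - r)^-1))).
  move=> ut t1 wr r1; rewrite /T opprD addrACA -!mulmxBr -conjmxB.
  apply: le_trans (vnorm_row_mul _ _ (vnorm_conj _)) _.
  by rewrite ler_wpM2l // remainder_diff.
pose L := k * (s * ((1 - rho)^-1 * (1 - rho)^-1 - 1)
               + lam * ((1 - rho)^-1 * (1 - rho)^-1)).
have P1 : 1 <= (1 - rho)^-1 by rewrite invf_ge1; lra.
have P2 : 1 <= (1 - rho)^-1 * (1 - rho)^-1 by rewrite mulr_ege1.
have [||||||u u_rho Tu] := @majorant_fixed_point _ _ T (majorant k s lam) rho L.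
- exact: ltW.
- have -> : majorant k s lam rho = k * (s * rho ^+ 2 + lam) * (1 - rho)^-1.
    by rewrite /majorant; field; lra.
  rewrite ler_pdivrMr; last by lra.
  nra.
- by rewrite /L mulr_ge0 // addr_ge0 // mulr_ge0 //; lra.
- rewrite /T /majorant !subr0 invr1 subrr mulr0 add0r mulr1.
  apply: le_trans (vnorm_row_mul _ _ (vnorm_conj _)) _.
  rewrite ler_wpM2l // remainder0; apply/vnorm_leP => // i.
  rewrite mxE normcM normc_real // -[leRHS]mulr1 ler_wpM2l //.
  exact: le_trans (le_vnorm _ _) d1.
- move=> t r u w r0 rt trho wr uw.
  have ut : vnorm u <= t.
    by rewrite -(subrK w u) (le_trans (vnormD_le _ _)) //; lra.
  have t1 : t < 1 by lra.
  have r1 : r < 1 by lra.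
  apply: le_trans (T_diff _ _ _ _ ut t1 wr r1) _.
  have -> : majorant k s lam t - majorant k s lam r = k * ((t - r) *
      (s * ((1 - t)^-1 * (1 - r)^-1 - 1) + lam * ((1 - t)^-1 * (1 - r)^-1))).
    by rewrite /majorant; field; rewrite !subr_eq0 !gt_eqF.
  have Pt : 1 <= (1 - t)^-1 by rewrite invf_ge1; lra.
  have Pr : 1 <= (1 - r)^-1 by rewrite invf_ge1; lra.
  have Ptr : 1 <= (1 - t)^-1 * (1 - r)^-1 by rewrite mulr_ege1.
  rewrite ler_wpM2l // ler_wpM2r //.
  by rewrite addr_ge0 // mulr_ge0 //; lra.
- move=> u w ur wr; apply: le_trans (T_diff _ _ _ _ ur _ wr _) _; try lra.
  by rewrite /L mulrCA mulrC.
by exists u => //; lra.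
Qed.

(** J commutes with the antilinear involution (x, z) |-> (conj z, conj x), and
    the right-hand side (conj (Z r), Z r) is invariant under it; hence so is the
    solution of the linear system, whose halves are thus conjugate to each
    other.  This gives the symmetric block structure of J^-1 where it is
    needed. *)
Lemma linearized_solve n (Y : 'M[C]_n) (V S r : 'cV[C]_n) :
  Jmat Y V S \in unitmx ->
  let Z := Zmat Y V in
  let u := Mmat Y V S *m conjmx Z *m conjmx r + Nmat Y V S *m Z *m r in
  conjmx u + Z *m diagv S *m u = Z *m r.
Proof.
move=> J_unit Z u; set J := Jmat Y V S in J_unit.
pose b := col_mx (conjmx (Z *m r)) (Z *m r).
have mulJ x z : J *m col_mx x z
    = col_mx (x + conjmx (Z *m diagv S) *m z) (Z *m diagv S *m x + z).
  rewrite /J /Jmat -/Z mul_block_col !mul1mx conjmxM conjmx_diagv.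
  by [].
pose x := invmx J *m b.
have Jx : J *m x = b by rewrite mulKVmx.
have xu : usubmx x = u.
  rewrite /x -[invmx J]submxK mul_block_col col_mxKu.
  by rewrite /u /Mmat /Nmat -/J conjmxM !mulmxA.
have : x = col_mx (conjmx (dsubmx x)) (conjmx (usubmx x)).
  apply: (can_inj (mulKmx J_unit)); rewrite Jx mulJ.
  move: Jx; rewrite -{1}[x]vsubmxK mulJ => /eq_col_mx [e1 e2].
  congr col_mx.
    by rewrite -e2 conjmxD [conjmx (_ *m usubmx x)]conjmxM addrC.
  by rewrite -[LHS]conjmxK -e1 conjmxD conjmxM conjmxK addrC.
move=> xE; have {}xE : dsubmx x = conjmx u by rewrite xE col_mxKd xu.
move: Jx; rewrite -{1}[x]vsubmxK mulJ xu xE => /eq_col_mx [_ <-].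
by rewrite addrC.
Qed.

(** Divide the power flow equation of V (1 + u) by 1 + u and subtract that of V:
    the result is the equation for u multiplied by the inverse of Z, which is
    [[V]] conj(Y) [[conj V]]. *)
Lemma solvable_of_relative n (Y : 'M[C]_n) V0 (V S d u : 'cV[C]_n) (lam : R) :
  Y \in unitmx -> (forall i, V i 0 != 0) -> power_flow Y V0 V S ->
  (forall i, 1 + u i 0 != 0) ->
  conjmx u + Zmat Y V *m diagv S *m u = Zmat Y V *m remainder S d lam u ->
  solvable Y V0 (S + lam%:C%C *: d).
Proof.
move=> Y_unit V_neq0 Vsol u_neq0 eq_u.
have DV := diagv_unit V_neq0.
have DVc : diagv (conjmx V) \in unitmx by rewrite -conjmx_diagv conjmx_unit.
have Yc : conjmx Y \in unitmx by rewrite conjmx_unit.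
have {}eq_u : conjmx Y *m (diagv (conjmx V) *m conjmx u)
    = invmx (diagv V) *m (remainder S d lam u - diagv S *m u).
  have -> : conjmx u = Zmat Y V *m (remainder S d lam u - diagv S *m u).
    by rewrite mulmxBr -eq_u mulmxA addrK.
  by rewrite /Zmat -!mulmxA mulKVmx // mulKVmx.
exists (V + diagv V *m u); rewrite /power_flow.
have -> : V + diagv V *m u - const_mx V0 = (V - const_mx V0) + diagv V *m u.
  by rewrite addrAC.
rewrite mulmxDr conjmxD [conjmx (Y *m (diagv V *m u))]conjmxM.
rewrite [conjmx (diagv V *m u)]conjmxM conjmx_diagv eq_u.
apply/matrixP => i j; rewrite ord1 mul_diagv.
have := congr1 (fun x : 'cV_n => x i 0) Vsol; rewrite mul_diagv.
set c := conjmx _; set e := invmx _ *m _ => cE.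
have eE : V i 0 * e i 0 = (remainder S d lam u - diagv S *m u) i 0.
  by rewrite -mul_diagv mulKVmx.
have addE (x z : 'cV[C]_n) : (x + z) i 0 = x i 0 + z i 0 by rewrite mxE.
have subE (x z : 'cV[C]_n) : (x - z) i 0 = x i 0 - z i 0 by rewrite !mxE.
have -> : (V + diagv V *m u) i 0 * (c + e) i 0
  = (1 + u i 0) * (V i 0 * c i 0 + V i 0 * e i 0).
  by rewrite !addE mul_diagv; ring.
by rewrite cE eE subE mul_diagv !mxE; field; exact: u_neq0.
Qed.

End Remainder.

(** * The constants of the gain equation *)

Section Coefficients.
Context {R : realType}.
Local Notation C := R[i].

Lemma Zmat_unit n (Y : 'M[C]_n) (V : 'cV[C]_n) :
  Y \in unitmx -> (forall i, V i 0 != 0) -> Zmat Y V \in unitmx.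
Proof.
move=> Y_unit V_neq0; have DV := diagv_unit V_neq0.
by rewrite !unitmx_mul !unitmx_inv -conjmx_diagv !conjmx_unit Y_unit DV.
Qed.

(** (M conj Z | N Z) is the upper half of J^-1 times diag (conj Z, Z). *)
Lemma mnorm_MNZ_le n (Y : 'M[C]_n) (V S : 'cV[C]_n) :
  mnorm (row_mx (Mmat Y V S *m conjmx (Zmat Y V)) (Nmat Y V S *m Zmat Y V))
  <= mnorm (invmx (Jmat Y V S)) * mnorm (Zmat Y V).
Proof.
set Ji := invmx _; set Z := Zmat Y V.
have -> : row_mx (Mmat Y V S *m conjmx Z) (Nmat Y V S *m Z)
    = usubmx Ji *m block_mx (conjmx Z) 0 0 Z.
  rewrite -[usubmx Ji]hsubmxK mul_row_block !mulmx0 addr0 add0r.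
  by [].
apply: le_trans (mnorm_mulmx _ _) _; apply: ler_pM; rewrite ?mnorm_ge0 //.
  by rewrite -{2}[Ji]vsubmxK mnorm_col_mx le_max lexx.
by rewrite /block_mx mnorm_col_mx mnorm_row_mx0 mnorm_row_0mx mnorm_conj maxxx.
Qed.

(** If both norms vanished, so would M and N, as Z is invertible; but they form
    the upper half of an invertible matrix of positive size. *)
Lemma MNZ_norm_gt0 n (Y : 'M[C]_n) (V S : 'cV[C]_n) :
  (0 < n)%N -> Y \in unitmx -> (forall i, V i 0 != 0) ->
  Jmat Y V S \in unitmx -> 0 < MNZ_norm Y V S.
Proof.
move=> n0 Y_unit V_neq0 J_unit; have Z_unit := Zmat_unit Y_unit V_neq0.
rewrite lt_neqAle addr_ge0 ?mnorm_ge0 // andbT eq_sym.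
rewrite /MNZ_norm paddr_eq0 ?mnorm_ge0 //; apply/negP => /andP[/eqP M0 /eqP N0].
have {}M0 : Mmat Y V S = 0.
  have Zc_unit : conjmx (Zmat Y V) \in unitmx by rewrite conjmx_unit.
  rewrite -[LHS](mulmxK Zc_unit).
  by rewrite (mnorm_eq0 M0) mul0mx.
have {}N0 : Nmat Y V S = 0.
  by rewrite -[LHS](mulmxK Z_unit) (mnorm_eq0 N0) mul0mx.
have U0 : usubmx (invmx (Jmat Y V S)) = 0.
  by rewrite -[LHS]hsubmxK [lsubmx _]M0 [rsubmx _]N0 row_mx0.
have := congr1 usubmx (mulVmx J_unit); rewrite -mul_usub_mx U0 mul0mx.
move/matrixP => /(_ (Ordinal n0) (lshift n (Ordinal n0))); rewrite !mxE eq_refl.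
by move=> /eqP; rewrite eq_sym oner_eq0.
Qed.

End Coefficients.

(** * The gain equation *)

Section Gain.
Context {R : rcfType}.

(** Squaring gives a polynomial equation on [0, 1 / (2 c)], where the square
    root equals the nonnegative 1/2 - c lam; the intermediate value theorem
    applies, the signs at the ends being those of -1 and of a nonnegative number. *)
Lemma gain_root_exists (c a s : R) : 0 < c -> 0 <= a -> 0 <= s ->
  exists2 lam, 0 < lam &
    2 * Num.sqrt (c * a * (lam * (s + lam))) + 2 * c * lam = 1.
Proof.
move=> c0 a0 s0.
pose p : {poly R} :=
  (4 * c * a) *: ('X * (s%:P + 'X)) - (1 - (2 * c) *: 'X) ^+ 2.
have pE x : p.[x] = 4 * c * a * (x * (s + x)) - (1 - 2 * c * x) ^+ 2.
  by rewrite /p !hornerE /= ?hornerE.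
pose m := (2 * c)^-1.
have mE : 2 * c * m = 1 by rewrite mulfV //; lra.
have m0 : 0 < m by rewrite invr_gt0; lra.
have [|lam /andP[l0 lm] /eqP] := @Num.poly_ivt R p 0 m (ltW m0).
  rewrite !pE; apply/andP; split; first by lra.
  by rewrite mE subrr expr0n subr0 !mulr_ge0 ?addr_ge0 //; lra.
rewrite pE => lE.
have l_neq0 : lam != 0 by apply/eqP => l; move: lE; rewrite l; lra.
have {l_neq0}l0 : 0 < lam by rewrite lt_neqAle eq_sym l_neq0.
exists lam => //.
have cl : 2 * c * lam <= 1.
  have : c * lam <= c * m by rewrite ler_pM2l.
  lra.
have -> : c * a * (lam * (s + lam)) = ((1 - 2 * c * lam) / 2) ^+ 2.
  by rewrite expr_div_n; lra.
by rewrite sqrtr_sqr ger0_norm; lra.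
Qed.

(** The left-hand side of the gain equation is strictly increasing. *)
Lemma gain_root_le (c a s lam mu : R) : 0 < c -> 0 <= a -> 0 <= s ->
  0 < lam ->
  2 * Num.sqrt (c * a * (lam * (s + lam))) + 2 * c * lam = 1 ->
  2 * Num.sqrt (c * a * (mu * (s + mu))) + 2 * c * mu = 1 ->
  mu <= lam.
Proof.
move=> c0 a0 s0 l0 lE mE; rewrite leNgt; apply/negP => lm.
have : Num.sqrt (c * a * (lam * (s + lam)))
    <= Num.sqrt (c * a * (mu * (s + mu))).
  rewrite ler_wsqrtr // ler_wpM2l ?mulr_ge0 ?(ltW c0) //.
  by rewrite ler_pM ?addr_ge0 ?lerD // ltW.
have : c * lam < c * mu by rewrite ltr_pM2l.
lra.
Qed.

(** Squared, the gain equation reads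
      4 c a lam s + 4 c lam + 4 c (a - c) lam^2 = 1.
    The first term dominates 4 k^2 lam s as k <= c and k <= a.  The others
    dominate 4 k lam: if c <= a this is k <= c; otherwise 2 c lam <= 1 bounds
    them below by 4 c lam - 2 (c - a) lam = 2 (c + a) lam, which is at
    least 4 k lam. *)
Lemma gain_root_condition (c a s k lam : R) :
  0 < c -> 0 <= a -> 0 <= s -> 0 <= k -> k <= c -> k <= a -> 0 < lam ->
  2 * Num.sqrt (c * a * (lam * (s + lam))) + 2 * c * lam = 1 ->
  2 * c * lam <= 1 /\ 4 * k * lam * (k * s + 1) <= 1.
Proof.
move=> c0 a0 s0 k0 kc ka l0 lE.
have cl : 2 * c * lam <= 1.
  by have := sqrtr_ge0 (c * a * (lam * (s + lam))); lra.
split=> //.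
have sq : c * a * (lam * (s + lam)) = ((1 - 2 * c * lam) / 2) ^+ 2.
  have -> : (1 - 2 * c * lam) / 2 = Num.sqrt (c * a * (lam * (s + lam))) by lra.
  by rewrite sqr_sqrtr // !mulr_ge0 ?addr_ge0 // ltW.
have kk : k * k * (lam * s) <= c * a * (lam * s).
  by rewrite ler_wpM2r ?mulr_ge0 ?(ltW l0) // ler_pM.
suff : 4 * (k * lam) <= 4 * (c * lam) + 4 * (c * lam) * ((a - c) * lam).
  move: sq; rewrite expr_div_n; lra.
have kcl : k * lam <= c * lam by rewrite ler_pM2r.
have cl0 : 0 < c * lam by rewrite mulr_gt0.
case: (leP c a) => ac.
  have : 0 <= (c * lam) * ((a - c) * lam).
    by rewrite !mulr_ge0 ?subr_ge0 ?(ltW l0) ?(ltW c0).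
  lra.
have kal : k * lam <= a * lam by rewrite ler_pM2r.
have acl : 0 <= (c - a) * lam by rewrite mulr_ge0 ?subr_ge0 ?ltW.
have : 2 * (c * lam) * ((c - a) * lam) <= 1 * ((c - a) * lam).
  by rewrite ler_wpM2r //; lra.
lra.
Qed.
End Gain.

Unset Implicit Arguments.

(** * The certified gain *)

Theorem theorem3 (R : realType) (n : nat) (n_gt0 : (0 < n)%N)
    (y : 'M[R[i]]_(1 + n)) (V0 : R[i]) (Vs Ss : 'cV[R[i]]_n)
    (Y_unit : pq_admittance y \in unitmx)
    (Vs_neq0 : forall i : 'I_n, Vs i 0 != 0)
    (Vs_sol : power_flow (pq_admittance y) V0 Vs Ss)
    (J_unit : Jmat (pq_admittance y) Vs Ss \in unitmx) :
  let Y := pq_admittance y in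
  (exists lamM : R, is_lambda_M Y Vs Ss lamM) /\
  (forall lamM : R, is_lambda_M Y Vs Ss lamM ->
    (forall dS : 'cV[R[i]]_n, vnorm dS = 1 ->
       solvable Y V0 (Ss + (lambda_CAG Y Vs Ss lamM)%:C%C *: dS)) /\
    ((lambda_CAG Y Vs Ss lamM)%:E <= worst_case_gain Y V0 Ss)%E).
Proof.
move=> Y.
set c := MNZ_norm Y Vs Ss.
set A := Mmat Y Vs Ss *m conjmx (Zmat Y Vs); set B := Nmat Y Vs Ss *m Zmat Y Vs.
pose a := mnorm (invmx (Jmat Y Vs Ss)) * mnorm (Zmat Y Vs).
pose s := vnorm Ss; pose k := mnorm (row_mx A B).
have a0 : 0 <= a by rewrite mulr_ge0 ?mnorm_ge0.
have s0 : 0 <= s := vnorm_ge0 _.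
have k0 : 0 <= k := mnorm_ge0 _.
have c0 : 0 < c := MNZ_norm_gt0 n_gt0 Y_unit Vs_neq0 J_unit.
have kc : k <= c := mnorm_row_mx _ _.
have ka : k <= a := mnorm_MNZ_le _ _ _.
have rootE lam : gain_root Y Vs Ss lam <->
    2 * Num.sqrt (c * a * (lam * (s + lam))) + 2 * c * lam = 1.
  by rewrite /gain_root -/c /a -/s !mulrA; split.
split.
  have [lam l0 lE] := gain_root_exists c0 a0 s0.
  exists lam; split=> // [|mu _ /rootE mE]; first exact/rootE.
  exact: gain_root_le lE mE.
move=> lam [l0 /rootE lE _].
have [cl kl] := gain_root_condition c0 a0 s0 k0 kc ka l0 lE.
have -> : lambda_CAG Y Vs Ss lam = lam.
  by apply/min_idPl; rewrite -/c ler_pdivlMr //; lra.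
have sol dS : vnorm dS = 1 -> solvable Y V0 (Ss + lam%:C%C *: dS).
  move=> d1.
  have dS1 : vnorm dS <= 1 by rewrite d1.
  have [u u1 Tu] := reduced_fixed_point (ltW l0) dS1 kl.
  apply: (solvable_of_relative Y_unit Vs_neq0 Vs_sol (u := u)).
    by move=> i; case: (inv1D_bound (le_vnorm u i) u1).
  by rewrite -[in LHS]Tu; exact: linearized_solve.
split=> //; apply: le_ereal_inf_tmp => _ [dS d1 <-].
by apply: ereal_sup_ubound; exists lam => //; split; [exact: ltW|exact: sol].
Qed.
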